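(* Let $\mathbf{k}$ be a unitary commutative ring, $\lambda\in\mathbf{k}$, and let $(A,d_0)$ be a commutative differential $\mathbf{k}$-algebra of weight $\lambda$. Let $\mathrm{Sh}(A)$ be the mixable shuffle algebra of weight $\lambda$ on $A$, with operators $P_A$ and $d_A$ and inclusion $j_A:A\to\mathrm{Sh}(A)$ as defined in the context. (a) $(\mathrm{Sh}(A),d_A,P_A)$ is a commutative differential Rota-Baxter $\mathbf{k}$-algebra of weight $\lambda$, and the $\mathbf{k}$-algebra embedding $j_A:A\to\mathrm{Sh}(A)$ is a morphism of differential $\mathbf{k}$-algebras of weight $\lambda$ from $(A,d_0)$ to $(\mathrm{Sh}(A),d_A)$. (b) The quadruple $(\mathrm{Sh}(A),d_A,P_A,j_A)$ is a free commutative differential Rota-Baxter $\mathbf{k}$-algebra of weight $\lambda$ on $(A,d_0)$: for any commutative differential Rota-Baxter $\mathbf{k}$-algebra $(R,d,P)$ of weight $\lambda$ and any homomorphism $\varphi:(A,d_0)\to(R,d)$ of differential $\mathbf{k}$-algebras of weight $\lambda$, there exists a unique homomorphism $\tilde\varphi:(\mathrm{Sh}(A),d_A,P_A)\to(R,d,P)$ of differential Rota-Baxter $\mathbf{k}$-algebras of weight $\lambda$ such that $\tilde\varphi\circ j_A=\varphi$. (c) Let $X$ be a set and let $(\mathbf{k}\{X\},d_X)$ be the free commutative differential algebra of weight $\lambda$ on $X$. Let $j_X:X\to\mathrm{Sh}(\mathbf{k}\{X\})$ be the composite of the canonical map $X\to\mathbf{k}\{X\}$ with $j_{\mathbf{k}\{X\}}$.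 The quadruple $(\mathrm{Sh}(\mathbf{k}\{X\}),d_{\mathbf{k}\{X\}},P_{\mathbf{k}\{X\}},j_X)$ is a free commutative differential Rota-Baxter $\mathbf{k}$-algebra of weight $\lambda$ on $X$: for any commutative differential Rota-Baxter $\mathbf{k}$-algebra $(R,d,P)$ of weight $\lambda$ and any set map $\varphi:X\to R$, there exists a unique homomorphism $\tilde\varphi:(\mathrm{Sh}(\mathbf{k}\{X\}),d_{\mathbf{k}\{X\}},P_{\mathbf{k}\{X\}})\to(R,d,P)$ of differential Rota-Baxter $\mathbf{k}$-algebras of weight $\lambda$ such that $\tilde\varphi\circ j_X=\varphi$.
   Context: Algebras are associative and unital, homomorphisms are unital, and tensor products are over $\mathbf{k}$. A differential $\mathbf{k}$-algebra of weight $\lambda$ is an associative $\mathbf{k}$-algebra $R$ with a $\mathbf{k}$-linear operator $d$ such that $d(xy)=d(x)y+xd(y)+\lambda d(x)d(y)$ for all $x,y\in R$, and $d(1)=0$. A Rota-Baxter $\mathbf{k}$-algebra of weight $\lambda$ is an associative $\mathbf{k}$-algebra $R$ with a $\mathbf{k}$-linear operator $P$ such that $P(x)P(y)=P(xP(y))+P(P(x)y)+\lambda P(xy)$ for all $x,y\in R$. A differential Rota-Baxter $\mathbf{k}$-algebra of weight $\lambda$ is a triple $(R,d,P)$ with $(R,d)$ a differential algebra of weight $\lambda$, $(R,P)$ a Rota-Baxter algebra of weight $\lambda$, and $d\circ P=\mathrm{id}_R$. Homomorphisms are $\mathbf{k}$-algebra homomorphisms commuting with the given operators. Mixable shuffle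 algebra. For a commutative $\mathbf{k}$-algebra $A$, let $\mathrm{Sh}(A)=\bigoplus_{k\ge 0}A^{\otimes(k+1)}=A\oplus A^{\otimes 2}\oplus\cdots$. Let $*$ be the $\mathbf{k}$-bilinear product on $\bigoplus_{k\ge0}A^{\otimes k}$ (with $A^{\otimes 0}=\mathbf{k}$, whose element $1$ is the identity for $*$) defined recursively, for $m,n\ge 1$, by $$(a_1\otimes\cdots\otimes a_m)*(b_1\otimes\cdots\otimes b_n)=a_1\otimes\big((a_2\otimes\cdots\otimes a_m)*(b_1\otimes\cdots\otimes b_n)\big)+b_1\otimes\big((a_1\otimes\cdots\otimes a_m)*(b_2\otimes\cdots\otimes b_n)\big)+\lambda\,a_1b_1\otimes\big((a_2\otimes\cdots\otimes a_m)*(b_2\otimes\cdots\otimes b_n)\big),$$ where empty tensors are read as $1\in A^{\otimes 0}$. The mixable shuffle product $\diamond$ on $\mathrm{Sh}(A)$ is the $\mathbf{k}$-bilinear product $$(a_0\otimes a_1\otimes\cdots\otimes a_m)\diamond(b_0\otimes b_1\otimes\cdots\otimes b_n)=(a_0b_0)\otimes\big((a_1\otimes\cdots\otimes a_m)*(b_1\otimes\cdots\otimes b_n)\big),\quad m,n\ge 0.$$ The algebra structure on $\mathrm{Sh}(A)$ is given by $\diamond$. The operator $P_A$ is the linear map with $P_A(x_0\otimes\cdots\otimes x_n)=1_A\otimes x_0\otimes\cdots\otimes x_n$, and $j_A:A\to\mathrm{Sh}(A)$ is the inclusion of the summand $A=A^{\otimes 1}$. For a commutative differential algebra $(A,d_0)$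 of weight $\lambda$, $d_A$ is the $\mathbf{k}$-linear operator on $\mathrm{Sh}(A)$ with $d_A(x_0)=d_0(x_0)$ and, for $n\ge1$, $$d_A(x_0\otimes x_1\otimes\cdots\otimes x_n)=d_0(x_0)\otimes x_1\otimes\cdots\otimes x_n+x_0x_1\otimes x_2\otimes\cdots\otimes x_n+\lambda\,d_0(x_0)x_1\otimes x_2\otimes\cdots\otimes x_n.$$ The free commutative differential algebra $(\mathbf{k}\{X\},d_X)$ of weight $\lambda$ on a set $X$ is the polynomial algebra $\mathbf{k}[x^{(n)}\mid x\in X,n\ge0]$ with the unique differential operator $d_X$ of weight $\lambda$ satisfying $d_X(x^{(n)})=x^{(n+1)}$; the canonical map $X\to\mathbf{k}\{X\}$ is $x\mapsto x^{(0)}$. *)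

(* Defs.v *)
From HB Require Import structures.
From mathcomp Require Import all_boot all_order all_algebra.
From mathcomp Require Import finmap boolp monalg.

Set Implicit Arguments.
Unset Strict Implicit.
Unset Printing Implicit Defensive.

Import GRing.Theory.
Local Open Scope ring_scope.

(* [comAlgType k] forces 1 != 0.  The theory below also covers k = 0 and the
   zero algebra, and Hierarchy-Builder admits no second join of [lmodType] and
   [comPzRingType], so the class is packed by hand. *)
Record comPzAlgType (k : pzRingType) := ComPzAlg {
  pzalg_ring : comPzRingType;
  pzalg_scale : k -> pzalg_ring -> pzalg_ring;
  pzalg_scaleA : forall a b x,
    pzalg_scale a (pzalg_scale b x) = pzalg_scale (a * b) x;
  pzalg_scale1 : left_id 1 pzalg_scale;
  pzalg_scaleDr : right_distributive pzalg_scale +%R;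
  pzalg_scaleDl : forall x, {morph pzalg_scale^~ x : a b / a + b};
  pzalg_scaleAl : forall c x y, pzalg_scale c (x * y) = pzalg_scale c x * y
}.

Definition pzalg_sort (k : pzRingType) (A : comPzAlgType k) : Type :=
  pzalg_ring A.
Coercion pzalg_sort : comPzAlgType >-> Sortclass.

Section ComPzAlgTheory.
Context {k : pzRingType} (A : comPzAlgType k).

HB.instance Definition _ :=
  GRing.ComPzRing.copy (pzalg_sort A) (pzalg_ring A).
HB.instance Definition _ := GRing.Zmodule_isLmodule.Build k (pzalg_sort A)
  (@pzalg_scaleA _ A) (@pzalg_scale1 _ A) (@pzalg_scaleDr _ A)
  (@pzalg_scaleDl _ A).

Lemma pzscalerAl (c : k) (x y : A) : c *: (x * y) = c *: x * y.
Proof. exact: pzalg_scaleAl. Qed.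

Lemma pzscalerAr (c : k) (x y : A) : c *: (x * y) = x * (c *: y).
Proof. by rewrite mulrC pzscalerAl mulrC. Qed.

End ComPzAlgTheory.

Definition comPzAlg_of_comAlg (k : pzRingType) (A : comAlgType k) :
    comPzAlgType k :=
  @ComPzAlg k A *:%R (@scalerA _ _) (@scale1r _ _) (@scalerDr _ _)
    (fun x a b => scalerDl x a b) (@scalerAl _ _).

Section Structures.
Context {k : comPzRingType}.

Record is_diff (lambda : k) (R : comPzAlgType k) (d : R -> R) : Prop := {
  diff_linear : linear d;
  diff_leibniz : forall x y,
    d (x * y) = d x * y + x * d y + lambda *: (d x * d y);
  diff_one : d 1 = 0
}.

Record is_rota_baxter (lambda : k) (R : comPzAlgType k) (P : R -> R) : Prop := {
  rb_linear : linear P;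
  rb_eq : forall x y,
    P x * P y = P (x * P y) + P (P x * y) + lambda *: P (x * y)
}.

Record is_diff_rota_baxter (lambda : k) (R : comPzAlgType k) (d P : R -> R) :
    Prop := {
  drb_diff : is_diff lambda d;
  drb_rb : is_rota_baxter lambda P;
  drb_section : forall x, d (P x) = x
}.

Record is_alg_hom (R S : comPzAlgType k) (f : R -> S) : Prop := {
  hom_linear : linear f;
  hom_monoid : monoid_morphism f
}.

Record is_diff_hom (R S : comPzAlgType k) (dR : R -> R) (dS : S -> S)
    (f : R -> S) : Prop := {
  dhom_alg : is_alg_hom f;
  dhom_d : forall x, f (dR x) = dS (f x)
}.

Record is_diff_rota_baxter_hom (R S : comPzAlgType k) (dR PR : R -> R)
    (dS PS : S -> S) (f : R -> S) : Prop := {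
  drbhom_diff : is_diff_hom dR dS f;
  drbhom_P : forall x, f (PR x) = PS (f x)
}.

End Structures.

Section LinearPredicate.
Context {k : pzRingType} {U V W : lmodType k}.
Implicit Types f g : U -> V.

Lemma linP f : linear f -> (forall x y, f (x + y) = f x + f y) /\
  (forall c x, f (c *: x) = c *: f x).
Proof.
move=> lf; have fD x y : f (x + y) = f x + f y.
  by have := lf 1 x y; rewrite !scale1r.
split=> // c x.
have f0 : f 0 = 0 by apply: (addrI (f 0)); rewrite -fD !addr0.
by have := lf c x 0; rewrite !addr0 f0 addr0.
Qed.

Lemma linD f : linear f -> forall x y, f (x + y) = f x + f y.
Proof. by move/linP => []. Qed.

Lemma linZ f : linear f -> forall c x, f (c *: x) = c *: f x.
Proof. by move/linP => []. Qed.

Lemma lin0 f : linear f -> f 0 = 0.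
Proof. by move=> lf; rewrite -(scale0r (0 : U)) (linZ lf) scale0r. Qed.

Lemma linB f : linear f -> forall x y, f (x - y) = f x - f y.
Proof. by move=> lf x y; rewrite (linD lf) -scaleN1r (linZ lf) scaleN1r. Qed.

Lemma lin_sum f (lf : linear f) I (r : seq I) (P : pred I) F :
  f (\sum_(i <- r | P i) F i) = \sum_(i <- r | P i) f (F i).
Proof. exact: (big_morph f (linD lf) (lin0 lf)). Qed.

Lemma lin_comp (f : U -> V) (g : V -> W) :
  linear f -> linear g -> linear (fun x => g (f x)).
Proof. by move=> lf lg c x y; rewrite lf lg. Qed.

Lemma lin_add f g : linear f -> linear g -> linear (fun x => f x + g x).
Proof.
by move=> lf lg c x y; rewrite lf lg scalerDr; rewrite addrACA.
Qed.

Lemma lin_zero : linear (fun _ : U => 0 : V).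
Proof. by move=> c x y; rewrite scaler0 addr0. Qed.

End LinearPredicate.

Lemma lin_id (k : pzRingType) (U : lmodType k) : linear (fun x : U => x).
Proof. by []. Qed.

Lemma lin_scale (k : comPzRingType) (U V : lmodType k) (f : U -> V) c :
  linear f -> linear (fun x => c *: f x).
Proof.
by move=> lf a x y; rewrite lf scalerDr !scalerA mulrC.
Qed.

Definition freemod (k : pzRingType) (W : choiceType) : Type := {malg k[W]}.
HB.instance Definition _ k W := GRing.Zmodule.on (freemod k W).

(* Locked: comparing two basis vectors by conversion unfolds finmap. *)
HB.lock Definition fm (k : pzRingType) (W : choiceType) (w : W) :
  freemod k W := << 1 *g w >>.
Arguments fm k {W} w.

Section FreeModule.
Context (k : pzRingType) (W : choiceType).
Local Notation freemod := (freemod k W).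
Local Notation fm := (@fm k W).
Implicit Types x y : freemod.

Definition fm_scale (c : k) (x : freemod) : freemod :=
  [malg w in msupp x => c * x@_w].

Lemma fm_scaleE c x w : (fm_scale c x)@_w = c * x@_w.
Proof.
rewrite mcoeffE; case: ifPn => // ; rewrite -mcoeff_eq0 => /eqP->.
by rewrite mulr0.
Qed.

Fact fm_scaleA a b x : fm_scale a (fm_scale b x) = fm_scale (a * b) x.
Proof. by apply/malgP => w; rewrite !fm_scaleE mulrA. Qed.
Fact fm_scale1 x : fm_scale 1 x = x.
Proof. by apply/malgP => w; rewrite !fm_scaleE mul1r. Qed.
Fact fm_scaleDr : right_distributive fm_scale +%R.
Proof.
by move=> c x y; apply/malgP => w; rewrite !(fm_scaleE, mcoeffD) mulrDr.
Qed.
Fact fm_scaleDl x : {morph fm_scale^~ x : a b / a + b}.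
Proof.
by move=> a b; apply/malgP => w; rewrite !(fm_scaleE, mcoeffD) mulrDl.
Qed.

HB.instance Definition _ := GRing.Zmodule_isLmodule.Build k freemod
  fm_scaleA fm_scale1 fm_scaleDr fm_scaleDl.

Context (M : lmodType k).

Definition fm_lin (f : W -> M) (x : freemod) : M :=
  \sum_(w <- msupp x) x@_w *: f w.

Lemma fm_linEw f x (D : {fset W}) : (msupp x `<=` D)%fset ->
  fm_lin f x = \sum_(w <- D) x@_w *: f w.
Proof.
move=> sD; rewrite /fm_lin (big_fset_incl _ sD) // => w _.
by rewrite -mcoeff_eq0 => /eqP->; rewrite scale0r.
Qed.

Lemma fm_lin_linear f : linear (fm_lin f).
Proof.
move=> c x y; pose D := (msupp x `|` msupp y `|` msupp (c *: x + y))%fset.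
rewrite (@fm_linEw f x D) ?(@fm_linEw f y D) ?(@fm_linEw f (c *: x + y) D).
- rewrite scaler_sumr -big_split /=; apply: eq_bigr => w _.
  by rewrite mcoeffD fm_scaleE scalerDl scalerA.
- by rewrite fsubsetUr.
- by rewrite /D fsubsetU // fsubsetUr.
- by rewrite /D -fsetUA fsubsetUl.
Qed.

Lemma fm_linE f w : fm_lin f (fm w) = f w.
Proof.
rewrite fm.unlock.
by rewrite (@fm_linEw f _ [fset w]%fset) ?msuppU_le // big_seq_fset1 mcoeffUU scale1r.
Qed.

Lemma fmE x : x = \sum_(w <- msupp x) x@_w *: fm w.
Proof.
rewrite {1}[x]monalgE; apply: eq_bigr => w _; apply/malgP => v.
by rewrite fm_scaleE fm.unlock !mcoeffU; case: eqP => _; rewrite ?mulr1 ?mulr0.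
Qed.

Lemma fm_ext (f g : freemod -> M) : linear f -> linear g ->
  (forall w, f (fm w) = g (fm w)) -> forall x, f x = g x.
Proof.
move=> lf lg fg x; rewrite [x]fmE (lin_sum lf) (lin_sum lg).
by apply: eq_bigr => w _; rewrite (linZ lf) (linZ lg) fg.
Qed.

End FreeModule.

Section ModuleQuotient.
Context (k : pzRingType) (V : lmodType k) (S : V -> Prop).

Definition submod_span : {pred V} := fun x => `[< forall T : V -> Prop,
  T 0 -> (forall (c : k) u v, T u -> T v -> T (c *: u + v)) ->
  (forall u, S u -> T u) -> T x >].

Lemma in_spanP x : x \in submod_span <-> forall T : V -> Prop,
  T 0 -> (forall (c : k) u v, T u -> T v -> T (c *: u + v)) ->
  (forall u, S u -> T u) -> T x.
Proof.
rewrite -[_ \in _]/(submod_span x); split; first by move=> h; apply: asboolW h.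
by move=> h; apply: asboolT.
Qed.

Lemma span0 : 0 \in submod_span.
Proof. by apply/in_spanP => T T0 _ _. Qed.

Lemma spanP c u v : u \in submod_span -> v \in submod_span ->
  c *: u + v \in submod_span.
Proof.
move=> /in_spanP su /in_spanP sv; apply/in_spanP => T T0 Tl TS.
exact: (Tl c u v (su T T0 Tl TS) (sv T T0 Tl TS)).
Qed.

Lemma spanS u : S u -> u \in submod_span.
Proof. by move=> Su; apply/in_spanP => T _ _; apply. Qed.

Lemma span_ind (T : V -> Prop) : T 0 ->
  (forall c u v, T u -> T v -> T (c *: u + v)) ->
  (forall u, S u -> T u) -> forall x, x \in submod_span -> T x.
Proof. by move=> T0 Tl TS x /in_spanP; apply. Qed.

Fact span_zmod_closed : zmod_closed submod_span.
Proof.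
split=> [|u v su sv]; first exact: span0.
by rewrite addrC -scaleN1r spanP.
Qed.
HB.instance Definition _ :=
  GRing.isZmodClosed.Build V submod_span span_zmod_closed.

Lemma spanZ c u : u \in submod_span -> c *: u \in submod_span.
Proof. by move=> su; rewrite -[_ *: _]addr0 spanP ?span0. Qed.

Definition modquot : Type := Quotient.quot submod_span.
HB.instance Definition _ := GRing.Zmodule.on modquot.
Implicit Types x y : modquot.

Definition cls (v : V) : modquot := \pi_(Quotient.quot submod_span)%qT v.
Definition rep (x : modquot) : V :=
  @repr V (Quotient.quot submod_span) x.

Lemma repK x : cls (rep x) = x. Proof. exact: reprK. Qed.

Lemma clsD u v : cls (u + v) = cls u + cls v.
Proof. exact: (Quotient.pi_add submod_span). Qed.

Lemma clsP u v : (u - v \in submod_span) <-> cls u = cls v.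
Proof.
rewrite (Quotient.idealrBE (submod_span : zmodClosed V)).
by split=> [/eqP|/eqP].
Qed.

Definition mq_scale (c : k) (x : modquot) : modquot := cls (c *: rep x).

Lemma cls_scale c u : cls (c *: u) = mq_scale c (cls u).
Proof.
apply/clsP; rewrite -scalerBr spanZ //; apply/clsP; by rewrite repK.
Qed.

Fact mq_scaleA a b x : mq_scale a (mq_scale b x) = mq_scale (a * b) x.
Proof. by rewrite -[x]repK -!cls_scale scalerA. Qed.
Fact mq_scale1 x : mq_scale 1 x = x.
Proof. by rewrite -[x]repK -!cls_scale scale1r. Qed.
Fact mq_scaleDr : right_distributive mq_scale +%R.
Proof.
by move=> c x y; rewrite -[x]repK -[y]repK -!(clsD, cls_scale) scalerDr.
Qed.
Fact mq_scaleDl x : {morph mq_scale^~ x : a b / a + b}.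
Proof. by move=> a b; rewrite -[x]repK -!(clsD, cls_scale) scalerDl. Qed.

HB.instance Definition _ := GRing.Zmodule_isLmodule.Build k modquot
  mq_scaleA mq_scale1 mq_scaleDr mq_scaleDl.

Lemma cls_linear : linear cls.
Proof. by move=> c u v; rewrite clsD cls_scale. Qed.

Lemma cls_rel u : S u -> cls u = 0.
Proof.
by move=> Su; rewrite -(lin0 cls_linear); apply/clsP; rewrite subr0 spanS.
Qed.

Lemma mq_repE (M : lmodType k) (f : V -> M) : linear f ->
  (forall u, S u -> f u = 0) -> forall v, f (rep (cls v)) = f v.
Proof.
move=> lf fS v; have: cls (rep (cls v)) = cls v by rewrite repK.
move/clsP => h; apply/eqP; rewrite -subr_eq0 -(linB lf); apply/eqP.
elim/span_ind: h => // [|c x y fx fy]; first exact: lin0.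
by rewrite lf fx fy scaler0 addr0.
Qed.

End ModuleQuotient.

Section TensorPower.
Context {k : pzRingType} (V : lmodType k) (n : nat).

Definition tset (t : n.-tuple V) (i : 'I_n) (a : V) : n.-tuple V :=
  [tuple if j == i then a else tnth t j | j < n].

Inductive multilinear_rel : freemod k (n.-tuple V) -> Prop :=
  MultilinearRel (t : n.-tuple V) (i : 'I_n) (c : k) (a b : V) :
    multilinear_rel (fm k (tset t i (c *: a + b))
                     - (c *: fm k (tset t i a) + fm k (tset t i b))).

Definition tpow : Type := modquot multilinear_rel.
HB.instance Definition _ := GRing.Lmodule.on tpow.

Definition tpure (t : n.-tuple V) : tpow := cls multilinear_rel (fm k t).

Lemma tpure_multilinear t i (c : k) a b :
  tpure (tset t i (c *: a + b)) = c *: tpure (tset t i a) + tpure (tset t i b).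
Proof.
have /cls_rel := MultilinearRel t i c a b.
rewrite (linB (cls_linear _)) => /eqP; rewrite subr_eq0 => /eqP.
by rewrite (cls_linear multilinear_rel).
Qed.

Context (M : lmodType k).

(* The linear map A^{\otimes n} -> M induced by f : A^n -> M; only meaningful
   when f is multilinear. *)
Definition tpow_lin (f : n.-tuple V -> M) (x : tpow) : M := fm_lin f (rep x).

Section Lift.
Variable f : n.-tuple V -> M.
Hypothesis f_multilinear : forall t i (c : k) a b,
  f (tset t i (c *: a + b)) = c *: f (tset t i a) + f (tset t i b).

Lemma tpow_lin_cls u : tpow_lin f (cls multilinear_rel u) = fm_lin f u.
Proof.
apply: mq_repE; first exact: fm_lin_linear.
have lf := fm_lin_linear f.
by move=> _ [t i c a b]; rewrite (linB lf) lf !fm_linE f_multilinear subrr.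
Qed.

Lemma tpow_linE t : tpow_lin f (tpure t) = f t.
Proof. by rewrite tpow_lin_cls fm_linE. Qed.

Lemma tpow_lin_linear : linear (tpow_lin f).
Proof.
move=> c x y; rewrite -[x]repK -[y]repK -(cls_linear multilinear_rel).
by rewrite !tpow_lin_cls (fm_lin_linear f).
Qed.
End Lift.

Lemma tpow_ext (f g : tpow -> M) : linear f -> linear g ->
  (forall t, f (tpure t) = g (tpure t)) -> forall x, f x = g x.
Proof.
move=> lf lg fg x; rewrite -[x]repK.
apply: (@fm_ext _ _ _ (fun u => f (cls _ u)) (fun u => g (cls _ u))) => //.
  exact: lin_comp (cls_linear multilinear_rel) lf.
exact: lin_comp (cls_linear multilinear_rel) lg.
Qed.

End TensorPower.

Section DirectSum.
Context {k : pzRingType} (V : nat -> lmodType k).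

Definition finite_support (x : forall n, V n) : bool :=
  `[< exists N, forall n, (N <= n)%N -> x n = 0 >].

Record dsum : Type := DSum {
  dsval :> forall n, V n;
  dsvalP : finite_support dsval
}.
HB.instance Definition _ := [isSub for dsval].
HB.instance Definition _ := [Choice of dsum by <:].
Implicit Types x y z : dsum.

Lemma dsumP x y : (forall n, x n = y n) -> x = y.
Proof. by move=> xy; apply: val_inj; apply: functional_extensionality_dep. Qed.

Fact ds_zero_supp : finite_support (fun n => 0).
Proof. by apply/asboolP; exists 0%N. Qed.
Fact ds_opp_supp x : finite_support (fun n => - x n).
Proof.
have /asboolP [N xN] := dsvalP x; apply/asboolP; exists N => n /xN ->.
by rewrite oppr0.
Qed.
Fact ds_add_supp x y : finite_support (fun n => x n + y n).
Proof.
have /asboolP [N xN] := dsvalP x; have /asboolP [N' yN] := dsvalP y.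
apply/asboolP; exists (maxn N N') => n; rewrite geq_max => /andP[/xN-> /yN->].
by rewrite addr0.
Qed.
Fact ds_scale_supp (c : k) x : finite_support (fun n => c *: x n).
Proof.
have /asboolP [N xN] := dsvalP x; apply/asboolP; exists N => n /xN ->.
by rewrite scaler0.
Qed.

Definition ds_zero := DSum ds_zero_supp.
Definition ds_opp x := DSum (ds_opp_supp x).
Definition ds_add x y := DSum (ds_add_supp x y).
Definition ds_scale (c : k) x := DSum (ds_scale_supp c x).

Fact ds_addA : associative ds_add.
Proof. by move=> x y z; apply: dsumP => n /=; rewrite addrA. Qed.
Fact ds_addC : commutative ds_add.
Proof. by move=> x y; apply: dsumP => n /=; rewrite addrC. Qed.
Fact ds_add0 : left_id ds_zero ds_add.
Proof. by move=> x; apply: dsumP => n /=; rewrite add0r. Qed.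
Fact ds_addN : left_inverse ds_zero ds_opp ds_add.
Proof. by move=> x; apply: dsumP => n /=; rewrite addNr. Qed.
HB.instance Definition _ :=
  GRing.isZmodule.Build dsum ds_addA ds_addC ds_add0 ds_addN.

Fact ds_scaleA a b x : ds_scale a (ds_scale b x) = ds_scale (a * b) x.
Proof. by apply: dsumP => n /=; rewrite scalerA. Qed.
Fact ds_scale1 x : ds_scale 1 x = x.
Proof. by apply: dsumP => n /=; rewrite scale1r. Qed.
Fact ds_scaleDr : right_distributive ds_scale +%R.
Proof. by move=> c x y; apply: dsumP => n /=; rewrite scalerDr. Qed.
Fact ds_scaleDl x : {morph ds_scale^~ x : a b / a + b}.
Proof. by move=> a b; apply: dsumP => n /=; rewrite scalerDl. Qed.
HB.instance Definition _ := GRing.Zmodule_isLmodule.Build k dsum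
  ds_scaleA ds_scale1 ds_scaleDr ds_scaleDl.

Definition ds_inj_fun n (v : V n) m : V m :=
  match n =P m with ReflectT e => ecast m (V m) e v | ReflectF _ => 0 end.

Lemma ds_inj_fun_same n (v : V n) : ds_inj_fun v n = v.
Proof.
by rewrite /ds_inj_fun; case: eqP => // e; rewrite (eq_axiomK e).
Qed.

Lemma ds_inj_fun_other n (v : V n) m : n != m -> ds_inj_fun v m = 0.
Proof. by rewrite /ds_inj_fun; case: eqP. Qed.

Fact ds_inj_supp n (v : V n) : finite_support (ds_inj_fun v).
Proof.
apply/asboolP; exists n.+1 => m lt_nm.
by rewrite ds_inj_fun_other // ltn_eqF.
Qed.

Definition ds_inj n (v : V n) : dsum := DSum (ds_inj_supp v).

Lemma ds_inj_linear n : linear (@ds_inj n).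
Proof.
move=> c u v; apply: dsumP => m /=; rewrite /ds_inj_fun.
by case: eqP => [e|_]; [case: m / e | rewrite scaler0 addr0].
Qed.

Context (M : lmodType k).

Definition ds_bound x : nat := projT1 (cid (asboolW (dsvalP x))).

Lemma ds_boundP x n : (ds_bound x <= n)%N -> x n = 0.
Proof. exact: (projT2 (cid (asboolW (dsvalP x)))). Qed.

Definition ds_lin (f : forall n, V n -> M) (x : dsum) : M :=
  \sum_(n < ds_bound x) f n (x n).

Section Lift.
Variable f : forall n, V n -> M.
Hypothesis f_linear : forall n, linear (@f n).

Lemma ds_linEw x N : (forall n, (N <= n)%N -> x n = 0) ->
  ds_lin f x = \sum_(n < N) f (x n).
Proof.
have key a b (ab : (a <= b)%N) : (forall n, (a <= n)%N -> x n = 0) ->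
    \sum_(n < a) f (x n) = \sum_(n < b) f (x n).
  move=> x0; rewrite -!(big_mkord xpredT (fun n => f (x n))).
  rewrite [RHS](@big_cat_nat _ _ _ a) //=.
  rewrite [X in _ + X]big_nat_cond [X in _ + X]big1 ?addr0 // => n.
  by rewrite andbT => /andP[an _]; rewrite x0 // (lin0 (@f_linear n)).
move=> xN; rewrite /ds_lin; case: (leqP N (ds_bound x)) => [le|/ltnW le].
  by rewrite [RHS](key _ _ le).
by rewrite (key _ _ le) //; apply: ds_boundP.
Qed.

Lemma ds_lin_linear : linear (ds_lin f).
Proof.
move=> c x y; pose N := maxn (ds_bound x) (ds_bound y).
have xN n : (N <= n)%N -> x n = 0.
  by rewrite geq_max => /andP[/ds_boundP].
have yN n : (N <= n)%N -> y n = 0.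
  by rewrite geq_max => /andP[_ /ds_boundP].
rewrite (ds_linEw xN) (ds_linEw yN) (@ds_linEw _ N); last first.
  by move=> n Nn /=; rewrite xN // yN // scaler0 addr0.
rewrite scaler_sumr -big_split /=; apply: eq_bigr => n _.
exact: f_linear.
Qed.

Lemma ds_linE n v : ds_lin f (@ds_inj n v) = f v.
Proof.
rewrite (@ds_linEw _ n.+1); last first.
  by move=> m lt_nm /=; rewrite ds_inj_fun_other // ltn_eqF.
rewrite big_ord_recr /= ds_inj_fun_same big1 ?add0r // => i _.
by rewrite ds_inj_fun_other ?(lin0 (@f_linear _)) // gtn_eqF.
Qed.
End Lift.

Lemma dsE x : x = \sum_(n < ds_bound x) ds_inj (x n).
Proof.
apply: dsumP => m.
have coef_sum (r : seq 'I_(ds_bound x)) (F : 'I_(ds_bound x) -> dsum) :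
    (\sum_(i <- r) F i : dsum) m = \sum_(i <- r) F i m.
  by elim/big_ind2: _ => //= ? ? ? ? <- <-.
rewrite coef_sum /=; case: (ltnP m (ds_bound x)) => [lt|ge].
  rewrite (bigD1 (Ordinal lt)) //= ds_inj_fun_same big1 ?addr0 // => i ne.
  by rewrite ds_inj_fun_other //; apply: contraNneq ne => e; apply/eqP/val_inj.
rewrite ds_boundP // big1 // => i _; rewrite ds_inj_fun_other //.
by rewrite ltn_eqF // (leq_trans (ltn_ord i)).
Qed.

Lemma ds_ext (f g : dsum -> M) : linear f -> linear g ->
  (forall n v, f (@ds_inj n v) = g (ds_inj v)) -> forall x, f x = g x.
Proof.
move=> lf lg fg x; rewrite [x]dsE (lin_sum lf) (lin_sum lg).
by apply: eq_bigr => n _; rewrite fg.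
Qed.

End DirectSum.

Section Words.
Context {k : comPzRingType} (A : comPzAlgType k).

(* \bigoplus_{n >= 0} A^{\otimes n}. *)
Definition tensors : Type := dsum (fun n => tpow A n).
HB.instance Definition _ := GRing.Lmodule.on tensors.

(* w_1 \otimes ... \otimes w_n *)
Definition tens (w : seq A) : tensors :=
  @ds_inj k (fun n => tpow A n) (size w) (tpure (in_tuple w)).

Lemma tens_tuple n (t : n.-tuple A) :
  tens t = @ds_inj k (fun n => tpow A n) n (tpure t).
Proof.
case: t => w sw; move/eqP: (sw) => e; case: n / e sw => sw.
by congr ds_inj; congr tpure; apply: val_inj.
Qed.

Definition multilin (M : lmodType k) (f : seq A -> M) :=
  forall (u v : seq A) (c : k) (a b : A),
  f (u ++ (c *: a + b) :: v) = c *: f (u ++ a :: v) + f (u ++ b :: v).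

Lemma tset_word n (t : n.-tuple A) (i : 'I_n) a :
  tset t i a = take i t ++ a :: drop i.+1 t :> seq A.
Proof.
have si : (i < size t)%N by rewrite size_tuple.
have st : size (take i t) = i by rewrite size_take si.
apply: (@eq_from_nth _ 0).
  by rewrite size_tuple size_cat st /= size_drop size_tuple; rewrite subnSK // subnKC // ltnW.
move=> j; rewrite size_tuple => ltj; pose j' := Ordinal ltj.
rewrite -[j]/(val j') -(tnth_nth _ (tset _ _ _)) tnth_mktuple.
rewrite (tnth_nth 0) /= -val_eqE /= nth_cat st.
case: ltngtP => [ltji|ltij|->].
- by rewrite nth_take.
- rewrite -[(j - i)%N]prednK ?subn_gt0 //= nth_drop; congr nth.
  by rewrite addSnnS prednK ?subn_gt0 // subnKC // ltnW.
- by rewrite subnn.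
Qed.

Lemma tset_cat (u v : seq A) a b (i : 'I_(size (u ++ a :: v))) :
  i = size u :> nat -> tset (in_tuple (u ++ a :: v)) i b = u ++ b :: v :> seq A.
Proof.
move=> iE; rewrite tset_word /= iE take_size_cat //.
by rewrite -(cat_rcons a) drop_size_cat ?size_rcons.
Qed.

Lemma tens_multilin : multilin tens.
Proof.
move=> u v c a b.
have lt : (size u < size (u ++ (0%R : A) :: v))%N.
  by rewrite size_cat /= -addSnnS leq_addr.
have E x : tens (u ++ x :: v) =
    @ds_inj k (fun n => tpow A n) _
      (tpure (tset (in_tuple (u ++ (0%R : A) :: v)) (Ordinal lt) x)).
  by rewrite -tens_tuple tset_cat.
by rewrite !E tpure_multilinear (@ds_inj_linear k (fun n => tpow A n)).
Qed.

Context (M : lmodType k).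

(* The linear map induced by f; only meaningful when f is multilinear. *)
Definition tens_lin (f : seq A -> M) : tensors -> M :=
  @ds_lin k (fun n => tpow A n) M
    (fun n => tpow_lin (fun t : n.-tuple A => f t)).

Section Lift.
Variable f : seq A -> M.
Hypothesis f_multilin : multilin f.

Fact tens_lin_tset n (t : n.-tuple A) i (c : k) a b :
  f (tset t i (c *: a + b)) = c *: f (tset t i a) + f (tset t i b).
Proof. by rewrite !tset_word f_multilin. Qed.

Lemma tens_lin_linear : linear (tens_lin f).
Proof.
by apply: ds_lin_linear => n; apply: tpow_lin_linear; apply: tens_lin_tset.
Qed.

Lemma tens_linE w : tens_lin f (tens w) = f w.
Proof.
rewrite /tens_lin /tens ds_linE.
  by rewrite tpow_linE //; apply: tens_lin_tset.
by move=> n; apply: tpow_lin_linear; apply: tens_lin_tset.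
Qed.
End Lift.

Lemma tens_ext (f g : tensors -> M) : linear f -> linear g ->
  (forall w, f (tens w) = g (tens w)) -> forall x, f x = g x.
Proof.
move=> lf lg fg; apply: ds_ext => // n.
have li := @ds_inj_linear k (fun n => tpow A n) n.
apply: tpow_ext; [exact: lin_comp li lf | exact: lin_comp li lg | move=> t].
by rewrite -tens_tuple fg.
Qed.

End Words.

Arguments multilin {k A M} f.
Arguments tens {k A} w.
Arguments tens_lin {k A M} f x.
Arguments tens_lin_linear {k A M f}.
Arguments tens_linE {k A M f}.
Arguments tens_ext {k A M f g}.

Section QuasiShuffle.
Context {k : comPzRingType} (lambda : k) {A : comPzAlgType k}.
Local Notation T := (tensors A).

(* a \otimes x *)
Definition tcons (a : A) (x : T) : T := tens_lin (fun w => tens (a :: w)) x.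

(* The product * on pure tensors. *)
Fixpoint qsh (u : seq A) : seq A -> T :=
  if u is a :: u' then
    fix qsh_u (v : seq A) : T :=
      if v is b :: v' then
        tcons a (qsh u' v) + tcons b (qsh_u v')
        + lambda *: tcons (a * b) (qsh u' v')
      else tens u
  else fun v => tens v.

Definition star (x y : T) : T :=
  tens_lin (fun u => tens_lin (fun v => qsh u v) y) x.

Lemma cons_multilin a : multilin (fun w => tens (a :: w) : T).
Proof. by move=> u v c x y; rewrite -!cat_cons tens_multilin. Qed.

Lemma tcons_linear a : linear (tcons a).
Proof. exact: tens_lin_linear (cons_multilin a). Qed.

Lemma tcons_tens a w : tcons a (tens w) = tens (a :: w).
Proof. exact: (tens_linE (cons_multilin a)). Qed.

Lemma tcons_linear_l x : linear (tcons^~ x).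
Proof.
move=> c a b; move: x; apply: tens_ext.
- exact: tcons_linear.
- apply: lin_add; last exact: tcons_linear.
  by apply: lin_scale; apply: tcons_linear.
- move=> w; rewrite !tcons_tens; exact: (@tens_multilin _ _ [::]).
Qed.

Lemma qsh0 u : qsh u [::] = tens u. Proof. by case: u. Qed.

Lemma qsh_cons a u b v : qsh (a :: u) (b :: v) =
  tcons a (qsh u (b :: v)) + tcons b (qsh (a :: u) v)
  + lambda *: tcons (a * b) (qsh u v).
Proof. by []. Qed.

Lemma qshC u v : qsh u v = qsh v u.
Proof.
elim: u v => [|a u IHu] v; first by rewrite qsh0.
elim: v => [|b v IHv]; first by rewrite qsh0.
by rewrite !qsh_cons IHu IHv IHu mulrC [X in X + _]addrC.
Qed.

Lemma qsh_multilin_r u : multilin (qsh u).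
Proof.
elim: u => [|x u IHu] p q c a b; first exact: tens_multilin.
have lc y := linD (tcons_linear y).
have lz y := linZ (tcons_linear y).
elim: p => [|y p IHp]; rewrite ?cat0s ?cat_cons !qsh_cons.
- have := IHu [::] q c a b; rewrite !cat0s => ->.
  rewrite tcons_linear tcons_linear_l mulrDr -pzscalerAr tcons_linear_l.
  rewrite !scalerDr !scalerA [c * _]mulrC -!scalerA.
  by rewrite (AC (2*2*2) ((1*3*5)*(2*4*6))).
- have := IHu (y :: p) q c a b; rewrite !cat_cons => ->.
  rewrite IHp IHu !tcons_linear !scalerDr !scalerA [c * _]mulrC -!scalerA.
  by rewrite (AC (2*2*2) ((1*3*5)*(2*4*6))).
Qed.

Lemma qsh_multilin_l v : multilin (qsh^~ v).
Proof. by move=> p q c a b; rewrite !(qshC _ v) qsh_multilin_r. Qed.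

Lemma qsh_lin_multilin y : multilin (fun u => tens_lin (qsh u) y).
Proof.
have l u := tens_lin_linear (qsh_multilin_r u).
move=> p q c a b; move: y; apply: tens_ext => //.
  by apply: lin_add => //; apply: lin_scale.
by move=> w; rewrite !(tens_linE (qsh_multilin_r _)) qsh_multilin_l.
Qed.

Lemma star_linear_l y : linear (star^~ y).
Proof. exact: tens_lin_linear (qsh_lin_multilin y). Qed.

Lemma star_tens_l u y : star (tens u) y = tens_lin (qsh u) y.
Proof. exact: (tens_linE (qsh_lin_multilin y)). Qed.

Lemma star_tens u v : star (tens u) (tens v) = qsh u v.
Proof. by rewrite star_tens_l (tens_linE (qsh_multilin_r u)). Qed.

Lemma star_linear_r x : linear (star x).
Proof.
move=> c y z; move: x; apply: tens_ext.
- exact: star_linear_l.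
- by apply: lin_add; [apply: lin_scale|]; apply: star_linear_l.
- by move=> u; rewrite !star_tens_l (tens_lin_linear (qsh_multilin_r u)).
Qed.

Lemma starC x y : star x y = star y x.
Proof.
move: x; apply: tens_ext; [exact: star_linear_l | exact: star_linear_r |].
move=> u; move: y; apply: tens_ext.
- exact: star_linear_r.
- exact: star_linear_l.
- by move=> v; rewrite !star_tens qshC.
Qed.

Lemma star1 x : star (tens [::]) x = x.
Proof.
move: x; apply: tens_ext => //; first exact: star_linear_r.
by move=> v; rewrite star_tens.
Qed.

Lemma star_cons a x b y : star (tcons a x) (tcons b y) =
  tcons a (star x (tcons b y)) + tcons b (star (tcons a x) y)
  + lambda *: tcons (a * b) (star x y).
Proof.
have lc := tcons_linear; have ll := star_linear_l; have lr := star_linear_r.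
move: x; apply: tens_ext.
- exact: lin_comp (lc _) (ll _).
- apply: lin_add; [apply: lin_add|apply: lin_scale].
  + exact: lin_comp (ll _) (lc _).
  + exact: lin_comp (lin_comp (lc _) (ll _)) (lc _).
  + exact: lin_comp (ll _) (lc _).
move=> u; move: y; apply: tens_ext.
- exact: lin_comp (lc _) (lr _).
- apply: lin_add; [apply: lin_add|apply: lin_scale].
  + exact: lin_comp (lin_comp (lc _) (lr _)) (lc _).
  + exact: lin_comp (lr _) (lc _).
  + exact: lin_comp (lr _) (lc _).
by move=> v; rewrite !tcons_tens !star_tens.
Qed.

Lemma starA x y z : star x (star y z) = star (star x y) z.
Proof.
have lc := tcons_linear; have ll := star_linear_l; have lr := star_linear_r.
move: x; apply: tens_ext.
- exact: ll.
- exact: lin_comp (ll _) (ll _).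
move=> u; move: y; apply: tens_ext.
- exact: lin_comp (ll _) (lr _).
- exact: lin_comp (lr _) (ll _).
move=> v; move: z; apply: tens_ext.
- exact: lin_comp (lr _) (lr _).
- exact: lr.
elim: u v => [|a u IHu] v w; first by rewrite !star1.
elim: v w => [|b v IHv] w; first by rewrite star1 (starC _ (tens [::])) star1.
elim: w => [|c w IHw]; first by rewrite !(starC _ (tens [::])) !star1.
move: IHu IHv IHw; rewrite -!tcons_tens.
set x := tens u; set y := tens v; set z := tens w => IHu IHv IHw.
have IHu1 : star x (star (tcons b y) (tcons c z)) =
    star (star x (tcons b y)) (tcons c z) by rewrite !tcons_tens IHu.
have IHu2 : star x (star (tcons b y) z) = star (star x (tcons b y)) z
  by rewrite !tcons_tens IHu.
have IHu3 : star x (star y (tcons c z)) = star (star x y) (tcons c z)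
  by rewrite !tcons_tens IHu.
have IHu4 : star x (star y z) = star (star x y) z by rewrite IHu.
have IHv1 : star (tcons a x) (star y (tcons c z)) =
    star (star (tcons a x) y) (tcons c z) by rewrite (tcons_tens c w : tcons c z = _) IHv.
have IHv2 : star (tcons a x) (star y z) = star (star (tcons a x) y) z
  by rewrite IHv.
rewrite [star (tcons b y) (tcons c z)]star_cons.
rewrite [star (tcons a x) (tcons b y)]star_cons.
rewrite !(linD (lr _)) !(linD (ll _)) !(linZ (lr _)) !(linZ (ll _)) !star_cons.
rewrite -IHu1 -IHv1 -IHu3 -IHu2 -IHv2 -IHu4.
rewrite IHw [star (tcons a x) (tcons b y)]star_cons.
rewrite [star (tcons b y) (tcons c z)]star_cons.
rewrite !(linD (lr _)) !(linD (ll _)) !(linZ (lr _)) !(linZ (ll _)).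
rewrite !(linD (lc _)).
rewrite !(linZ (lc _)).
rewrite mulrA.
do 11?[move: (tcons _ _) => ?].
rewrite !scalerDr.
by rewrite (AC (3*(1*3*1)*3) ((1*4*9)*5*8*(2*6*10)*(3*7*11))).
Qed.

End QuasiShuffle.

Section MixableShuffle.
Context {k : comPzRingType}.

(* lambda is a phantom here: it selects the product defined below. *)
Definition Sh (lambda : k) (A : comPzAlgType k) : Type :=
  dsum (fun n => tpow A n.+1).
HB.instance Definition _ lambda A := GRing.Lmodule.on (Sh lambda A).

Context (lambda : k) (A : comPzAlgType k).
Local Notation T := (tensors A).
Local Notation S := (Sh lambda A).
Local Notation star := (@star k lambda A).
Local Notation inj n := (@ds_inj k (fun m => tpow A m.+1) n).

(* a \otimes w_1 \otimes ... \otimes w_n *)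
Definition sh (a : A) (w : seq A) : S :=
  inj (size w) (tpure [tuple of a :: in_tuple w]).

Definition sh_multilin (M : lmodType k) (f : A -> seq A -> M) :=
  (forall a, multilin (f a)) /\ (forall w, linear (f^~ w)).

Lemma sh_tuple n (t : n.+1.-tuple A) :
  sh (thead t) (behead t) = inj n (tpure t).
Proof.
case: t => -[//|a w] sw; move/eqP: (sw) => -[e]; case: n / e sw => sw.
by congr ds_inj; congr tpure; apply: val_inj.
Qed.

Lemma sh_multilinear : sh_multilin sh.
Proof.
have key n (t : n.+1.-tuple A) i x : inj n (tpure (tset t i x)) =
    sh (thead (tset t i x)) (behead (tset t i x)) by rewrite sh_tuple.
split=> [a u v c x y|w c x y].
- have lt : ((size u).+1 < (size (u ++ (0%R : A) :: v)).+1)%N.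
    by rewrite size_cat /= ltnS -addSnnS leq_addr.
  pose t := [tuple of a :: in_tuple (u ++ (0%R : A) :: v)].
  have E z : sh a (u ++ z :: v) = inj _ (tpure (tset t (Ordinal lt) z)).
    rewrite key; congr sh.
      by rewrite /thead tnth_mktuple -val_eqE /=.
    by rewrite tset_word /= take_size_cat // -(cat_rcons 0) drop_size_cat
      ?size_rcons.
  by rewrite !E tpure_multilinear (@ds_inj_linear k (fun n => tpow A n.+1)).
- pose t := [tuple of (0%R : A) :: in_tuple w].
  have E z : sh z w = inj _ (tpure (tset t ord0 z)).
    by rewrite key; congr sh; rewrite ?tset_word /= ?drop0 // /thead tnth_mktuple.
  by rewrite !E tpure_multilinear (@ds_inj_linear k (fun n => tpow A n.+1)).
Qed.

Section Lift.
Context (M : lmodType k).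

(* The linear map induced by f; only meaningful when f is multilinear. *)
Definition sh_lin (f : A -> seq A -> M) : S -> M :=
  @ds_lin k (fun n => tpow A n.+1) M
    (fun n => tpow_lin (fun t : n.+1.-tuple A => f (thead t) (behead t))).

Section LiftTheory.
Variable f : A -> seq A -> M.
Hypothesis f_multilin : sh_multilin f.

Fact sh_lin_tset n (t : n.+1.-tuple A) i (c : k) a b :
  let g (t : n.+1.-tuple A) := f (thead t) (behead t) in
  g (tset t i (c *: a + b)) = c *: g (tset t i a) + g (tset t i b).
Proof.
have [fm fl] := f_multilin; case: i => -[|i] lt /=.
  have B x : behead (tset t (Ordinal lt) x) = behead t.
    by rewrite tset_word take0 /= drop1.
  have H x : thead (tset t (Ordinal lt) x) = x.
    by rewrite /thead tnth_mktuple -val_eqE /=.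
  by rewrite !B !H fl.
have B x : behead (tset t (Ordinal lt) x) =
    take i (behead t) ++ x :: drop i.+1 (behead t).
  by rewrite tset_word /=; case: (tval t) (size_tuple t).
have H x : thead (tset t (Ordinal lt) x) = thead t.
  by rewrite /thead tnth_mktuple -val_eqE /=.
by rewrite !B !H fm.
Qed.

Lemma sh_lin_linear : linear (sh_lin f).
Proof.
by apply: ds_lin_linear => n; apply: tpow_lin_linear; apply: sh_lin_tset.
Qed.

Lemma sh_linE a w : sh_lin f (sh a w) = f a w.
Proof.
rewrite /sh_lin /sh ds_linE.
  by rewrite tpow_linE //; apply: sh_lin_tset.
by move=> n; apply: tpow_lin_linear; apply: sh_lin_tset.
Qed.
End LiftTheory.

Lemma sh_ext (f g : S -> M) : linear f -> linear g ->
  (forall a w, f (sh a w) = g (sh a w)) -> forall x, f x = g x.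
Proof.
move=> lf lg fg; apply: ds_ext => // n.
have li := @ds_inj_linear k (fun n => tpow A n.+1) n.
apply: tpow_ext; [exact: lin_comp li lf | exact: lin_comp li lg | move=> t].
by rewrite -sh_tuple fg.
Qed.

End Lift.

(* a \otimes x *)
Definition shT (a : A) (x : T) : S := tens_lin (sh a) x.

Definition sh_mul (x y : S) : S :=
  sh_lin (fun a u => sh_lin (fun b v => shT (a * b) (qsh lambda u v)) y) x.

Definition sh_one : S := sh 1 [::].

Lemma shT_linear a : linear (shT a).
Proof. exact: tens_lin_linear (sh_multilinear.1 a). Qed.

Lemma shT_tens a w : shT a (tens w) = sh a w.
Proof. exact: (tens_linE (sh_multilinear.1 a)). Qed.

Lemma shT_linear_l x : linear (shT^~ x).
Proof.
move=> c a b; move: x; apply: tens_ext.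
- exact: shT_linear.
- by apply: lin_add; [apply: lin_scale|]; apply: shT_linear.
- by move=> w; rewrite !shT_tens; apply: sh_multilinear.2.
Qed.

Lemma shT_ext (M : lmodType k) (f g : S -> M) : linear f -> linear g ->
  (forall a x, f (shT a x) = g (shT a x)) -> forall x, f x = g x.
Proof.
by move=> lf lg fg; apply: sh_ext => // a w; rewrite -shT_tens fg.
Qed.

Lemma mul_multilin_r a u :
  sh_multilin (fun b v => shT (a * b) (qsh lambda u v)).
Proof.
split=> [b p q c x y|w c x y].
  by rewrite qsh_multilin_r shT_linear.
by rewrite mulrDr -pzscalerAr shT_linear_l.
Qed.

Lemma mul_multilin_l y : sh_multilin
  (fun a u => sh_lin (fun b v => shT (a * b) (qsh lambda u v)) y).
Proof.
pose F a u : S -> S := sh_lin (fun b v => shT (a * b) (qsh lambda u v)).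
have Fl a u : linear (F a u) := sh_lin_linear (mul_multilin_r a u).
have FE a u b v : F a u (sh b v) = shT (a * b) (qsh lambda u v) :=
  sh_linE (mul_multilin_r a u) b v.
suff: sh_multilin (fun a u => F a u y) by [].
clearbody F; split=> [a p q c x z|w c x z]; move: y; apply: sh_ext => //.
- by apply: lin_add => //; apply: lin_scale.
- by move=> b v; rewrite !FE qsh_multilin_l shT_linear.
- by apply: lin_add => //; apply: lin_scale.
- by move=> b v; rewrite !FE mulrDl -pzscalerAl shT_linear_l.
Qed.

Lemma sh_mul_linear_l y : linear (sh_mul^~ y).
Proof. exact: sh_lin_linear (mul_multilin_l y). Qed.

Lemma sh_mul_sh_l a u y :
  sh_mul (sh a u) y = sh_lin (fun b v => shT (a * b) (qsh lambda u v)) y.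
Proof. exact: (sh_linE (mul_multilin_l y)). Qed.

Lemma sh_mul_sh a u b v :
  sh_mul (sh a u) (sh b v) = shT (a * b) (qsh lambda u v).
Proof. by rewrite sh_mul_sh_l (sh_linE (mul_multilin_r a u)). Qed.

Lemma sh_mul_linear_r x : linear (sh_mul x).
Proof.
move=> c y z; move: x; apply: sh_ext.
- exact: sh_mul_linear_l.
- by apply: lin_add; [apply: lin_scale|]; apply: sh_mul_linear_l.
- by move=> a u; rewrite !sh_mul_sh_l (sh_lin_linear (mul_multilin_r a u)).
Qed.

Lemma sh_mul_shT a x b y : sh_mul (shT a x) (shT b y) = shT (a * b) (star x y).
Proof.
have ll := sh_mul_linear_l; have lr := sh_mul_linear_r; have lt := shT_linear.
move: x; apply: tens_ext.
- exact: lin_comp (lt _) (ll _).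
- exact: lin_comp (star_linear_l _ _) (lt _).
move=> u; move: y; apply: tens_ext.
- exact: lin_comp (lt _) (lr _).
- exact: lin_comp (star_linear_r _ _) (lt _).
by move=> v; rewrite !shT_tens sh_mul_sh star_tens.
Qed.

Fact sh_mulC : commutative sh_mul.
Proof.
have ll := sh_mul_linear_l; have lr := sh_mul_linear_r.
move=> x y; move: x; apply: shT_ext => // a x; move: y.
by apply: shT_ext => // b y; rewrite !sh_mul_shT mulrC starC.
Qed.

Fact sh_mulA : associative sh_mul.
Proof.
have ll := sh_mul_linear_l; have lr := sh_mul_linear_r.
move=> x y z; move: x; apply: shT_ext => //; first exact: lin_comp (ll _) (ll _).
move=> a x; move: y; apply: shT_ext => //.
- exact: lin_comp (ll _) (lr _).
- exact: lin_comp (lr _) (ll _).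
move=> b y; move: z; apply: shT_ext => //; first exact: lin_comp (lr _) (lr _).
by move=> c z; rewrite !sh_mul_shT mulrA starA.
Qed.

Fact sh_mul1 : left_id sh_one sh_mul.
Proof.
have lr := sh_mul_linear_r.
move=> x; move: x; apply: shT_ext => // a x.
by rewrite /sh_one -shT_tens sh_mul_shT mul1r star1.
Qed.

Fact sh_mulDl : left_distributive sh_mul +%R.
Proof. by move=> x y z; rewrite (linD (sh_mul_linear_l z)). Qed.

HB.instance Definition _ := GRing.Zmodule_isComPzRing.Build S
  sh_mulA sh_mulC sh_mul1 sh_mulDl.

Fact sh_scaleAl (c : k) (x y : S) : c *: (x * y) = c *: x * y.
Proof. by rewrite [RHS](linZ (sh_mul_linear_l y)). Qed.

Definition Sh_alg : comPzAlgType k :=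
  @ComPzAlg k S *:%R (@scalerA _ _) (@scale1r _ _) (@scalerDr _ _)
    (fun x a b => scalerDl x a b) sh_scaleAl.

Definition j_Sh (a : A) : Sh_alg := sh a [::].

Definition P_Sh (x : Sh_alg) : Sh_alg := sh_lin (fun a w => sh 1 (a :: w)) x.

Definition d_Sh (d0 : A -> A) (x : Sh_alg) : Sh_alg := sh_lin (fun a w =>
  if w is b :: w' then
    sh (d0 a) w + sh (a * b) w' + lambda *: sh (d0 a * b) w'
  else sh (d0 a) [::]) x.

End MixableShuffle.

Arguments Sh_alg {k} lambda A.
Arguments j_Sh {k} lambda {A} a.
Arguments P_Sh {k} lambda {A} x.
Arguments d_Sh {k} lambda {A} d0 x.

Section PolynomialAlgebra.
Context (k : comPzRingType) (Y : choiceType).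

(* The polynomial algebra k[Y], as the monoid algebra of the free commutative
   monoid on Y; [{malg k[_]}] has a product only for a nontrivial k. *)
Definition palg : Type := freemod k {cmonom Y}.
HB.instance Definition _ := GRing.Lmodule.on palg.

Definition pmon (m : {cmonom Y}) : palg := fm k m.

Definition pmul (x y : palg) : palg :=
  fm_lin (fun m => fm_lin (fun n => pmon (mmul m n)) y) x.

Lemma palg_ext (M : lmodType k) (f g : palg -> M) : linear f -> linear g ->
  (forall m, f (pmon m) = g (pmon m)) -> forall x, f x = g x.
Proof. exact: fm_ext. Qed.

Lemma pmul_linear_l y : linear (pmul^~ y).
Proof. exact: fm_lin_linear. Qed.

Lemma pmul_mon_l m y : pmul (pmon m) y = fm_lin (fun n => pmon (mmul m n)) y.
Proof. exact: fm_linE. Qed.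

Lemma pmul_mon m n : pmul (pmon m) (pmon n) = pmon (mmul m n).
Proof. by rewrite pmul_mon_l fm_linE. Qed.

Lemma pmul_linear_r x : linear (pmul x).
Proof.
move=> c y z; move: x; apply: palg_ext.
- exact: pmul_linear_l.
- by apply: lin_add; [apply: lin_scale|]; apply: pmul_linear_l.
- by move=> m; rewrite !pmul_mon_l fm_lin_linear.
Qed.

Fact pmulC : commutative pmul.
Proof.
have ll := pmul_linear_l; have lr := pmul_linear_r.
move=> x y; move: x; apply: palg_ext; [exact: ll | exact: lr | move=> m].
move: y; apply: palg_ext; [exact: lr | exact: ll | move=> n].
by rewrite !pmul_mon mulmC.
Qed.

Fact pmulA : associative pmul.
Proof.
have ll := pmul_linear_l; have lr := pmul_linear_r.
move=> x y z; move: x; apply: palg_ext.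
- exact: ll.
- exact: lin_comp (ll _) (ll _).
move=> m; move: y; apply: palg_ext.
- exact: lin_comp (ll _) (lr _).
- exact: lin_comp (lr _) (ll _).
move=> n; move: z; apply: palg_ext.
- exact: lin_comp (lr _) (lr _).
- exact: lr.
by move=> p; rewrite !pmul_mon mulmA.
Qed.

Fact pmul1 : left_id (pmon mone) pmul.
Proof.
have lr := pmul_linear_r.
move=> x; move: x; apply: palg_ext; [exact: lr | by [] |].
by move=> m; rewrite pmul_mon mul1m.
Qed.

Fact pmulDl : left_distributive pmul +%R.
Proof. by move=> x y z; rewrite (linD (pmul_linear_l z)). Qed.

HB.instance Definition _ := GRing.Zmodule_isComPzRing.Build palg
  pmulA pmulC pmul1 pmulDl.

Fact pscaleAl (c : k) (x y : palg) : c *: (x * y) = c *: x * y.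
Proof. by rewrite [RHS](linZ (pmul_linear_l y)). Qed.

Definition poly_alg : comPzAlgType k :=
  @ComPzAlg k palg *:%R (@scalerA _ _) (@scale1r _ _) (@scalerDr _ _)
    (fun x a b => scalerDl x a b) pscaleAl.

Definition pvar (y : Y) : poly_alg := pmon (ucm y).

(* The variables of m, repeated according to their exponents. *)
Definition cmonom_vars (m : {cmonom Y}) : seq Y :=
  flatten [seq nseq (m y) y | y <- finsupp m].

Lemma count_cmonom_vars m y : count_mem y (cmonom_vars m) = m y.
Proof.
rewrite /cmonom_vars count_flatten -map_comp.
rewrite (eq_map (g := fun z => (z == y) * m z)%N); last first.
  by move=> z /=; rewrite count_nseq.
rewrite sumnE big_map; case: (mdomP m y) => [iny|outy].
  rewrite (big_fsetD1 y) //= eqxx mul1n big_seq big1 ?addn0 // => z.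
  by rewrite !inE => /andP[/negPf-> _].
rewrite big_seq big1 // => z inz; case: eqP => // zy.
by rewrite -zy inz in outy.
Qed.

Lemma pmonM m n : pmon (mmul m n) = pmon m * pmon n :> poly_alg.
Proof. by rewrite -pmul_mon. Qed.

Lemma cmonom_vars_perm m s : perm_eq (cmonom_vars m) s ->
  pmon m = \prod_(y <- s) pvar y.
Proof.
have -> : \prod_(y <- s) pvar y = pmon (\big[mmul/mone]_(y <- s) ucm y).
  elim: s => [|y s IH]; first by rewrite !big_nil.
  by rewrite !big_cons IH pmonM.
move=> /permP ms; congr pmon; apply/eqP/cmP => y.
rewrite -count_cmonom_vars ms; elim: s {ms} => [|z s IH].
  by rewrite big_nil cm1.
by rewrite big_cons cmM cmU /= IH.
Qed.

Lemma pmonE m : pmon m = \prod_(y <- cmonom_vars m) pvar y.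
Proof. exact: cmonom_vars_perm. Qed.

End PolynomialAlgebra.

Section FreeDifferentialAlgebra.
Context {k : comPzRingType} (lambda : k) (X : Type).

(* [{classic X}] is X with a classically obtained choiceType structure; the
   variable (x, n) is x^{(n)}. *)
Definition diff_poly : comPzAlgType k :=
  poly_alg k ({classic X} * nat)%type.

Definition dvar (x : X) (n : nat) : diff_poly :=
  @pvar k ({classic X} * nat)%type (x, n).

Local Notation Y := ({classic X} * nat)%type.
Local Notation pword s := (\prod_(y <- s) @pvar k Y y).

Fixpoint dword (s : seq Y) : diff_poly :=
  if s is (x, n) :: s' then
    dvar x n.+1 * pword s' + dvar x n * dword s'
    + lambda *: (dvar x n.+1 * dword s')
  else 0.

Definition d_poly : diff_poly -> diff_poly :=
  fm_lin (fun m => dword (cmonom_vars m)).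

Lemma dword_cat s t : dword (s ++ t) =
  dword s * pword t + pword s * dword t + lambda *: (dword s * dword t).
Proof.
elim: s => [|[x n] s IH] /=.
  by rewrite big_nil mul1r !mul0r scaler0 addr0 add0r.
rewrite IH big_cat big_cons /= -/(dvar x n).
move: (dvar x n) (dvar x n.+1) (dword s) (dword t) => a a' ds dt.
move: (\prod_(y <- s) _) (\prod_(y <- t) _) => p q.
rewrite !(mulrDl, mulrDr) -!pzscalerAl -!pzscalerAr !scalerDr !mulrA.
by rewrite (AC (1*3*3) ((1*2*5)*3*(6*4*7))).
Qed.

Lemma dword_catCA s t u : dword (s ++ t ++ u) = dword (t ++ s ++ u).
Proof.
have C : dword (s ++ t) = dword (t ++ s).
  rewrite (dword_cat s t) (dword_cat t s).
  move: (dword s) (dword t) (\prod_(y <- s) _) (\prod_(y <- t) _) => a b p q.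
  by rewrite [b * a]mulrC [b * p]mulrC [q * a]mulrC [p * b + _]addrC.
have P : pword (s ++ t) = pword (t ++ s) by rewrite !big_cat /= mulrC.
by rewrite !catA dword_cat C P -dword_cat.
Qed.

Lemma dword_perm s t : perm_eq s t -> dword s = dword t.
Proof.
elim: s t => [|y s IH] t st; first by move/perm_size/esym/size0nil: st => ->.
have /path.splitPr e : y \in t by rewrite -(perm_mem st) mem_head.
case: e st => t1 t2 st; have st' : perm_eq s (t1 ++ t2).
  by rewrite -(perm_cons y) (perm_trans st) // -cat1s perm_catCA.
transitivity (dword ([:: y] ++ t1 ++ t2)); last exact: dword_catCA.
rewrite -(cat1s y s) (dword_cat [:: y] s) (dword_cat [:: y] (t1 ++ t2)).
by rewrite -(IH _ st') -(perm_big _ st').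
Qed.

Lemma d_poly_linear : linear d_poly.
Proof. exact: fm_lin_linear. Qed.

Lemma d_poly_word s : d_poly (pword s) = dword s.
Proof.
pose m := \big[mmul/mone]_(y <- s) ucm y : {cmonom Y}.
have sm : perm_eq (cmonom_vars m) s.
  apply/allP => y _ /=; rewrite count_cmonom_vars /m; apply/eqP.
  elim: s {m} => [|z s IH]; first by rewrite big_nil cm1.
  by rewrite big_cons cmM cmU /= IH.
by rewrite -(cmonom_vars_perm k sm) /d_poly fm_linE (dword_perm sm).
Qed.

Lemma diff_poly_ext (M : lmodType k) (f g : diff_poly -> M) :
  linear f -> linear g -> (forall s, f (pword s) = g (pword s)) ->
  forall x, f x = g x.
Proof.
by move=> lf lg fg; apply: palg_ext => // m; rewrite pmonE; apply: fg.
Qed.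

Lemma d_poly_diff : is_diff lambda d_poly.
Proof.
have ld := d_poly_linear.
have mr (x : diff_poly) : linear (fun y : diff_poly => x * y).
  by move=> c y z; rewrite mulrDr -pzscalerAr.
have ml (x : diff_poly) : linear (fun y : diff_poly => y * x).
  by move=> c y z; rewrite mulrDl -pzscalerAl.
split=> [//|x y|]; last by have := d_poly_word [::]; rewrite big_nil.
move: x; apply: diff_poly_ext.
- exact: lin_comp (ml _) ld.
- apply: lin_add; [apply: lin_add|apply: lin_scale].
  + exact: lin_comp ld (ml _).
  + exact: ml.
  + exact: lin_comp ld (ml _).
move=> s; move: y; apply: diff_poly_ext.
- exact: lin_comp (mr _) ld.
- apply: lin_add; [apply: lin_add|apply: lin_scale].
  + exact: mr.
  + exact: lin_comp ld (mr _).
  + exact: lin_comp ld (mr _).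
by move=> t; rewrite -big_cat !d_poly_word dword_cat.
Qed.

Lemma d_poly_var x n : d_poly (dvar x n) = dvar x n.+1.
Proof.
have := d_poly_word [:: (x, n)]; rewrite big_seq1 => -> /=.
by rewrite big_nil mulr1 !mulr0 scaler0 !addr0.
Qed.

(* d_poly is the operator d_X of the definition of k{X}. *)
Lemma d_poly_unique (d : diff_poly -> diff_poly) : is_diff lambda d ->
  (forall x n, d (dvar x n) = dvar x n.+1) -> d =1 d_poly.
Proof.
move=> dd dv; have [ld lb d1] := dd.
apply: diff_poly_ext => //; first exact: d_poly_linear.
elim=> [|[x n] s IH]; first by rewrite big_nil d1 (diff_one d_poly_diff).
by rewrite big_cons lb IH dv (diff_leibniz d_poly_diff) d_poly_var.
Qed.

Definition j_diff_poly (x : X) : Sh_alg lambda diff_poly :=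
  j_Sh lambda (dvar x 0).

End FreeDifferentialAlgebra.

Arguments diff_poly k X : clear implicits.
Arguments d_poly {k} lambda {X} x.
Arguments j_diff_poly {k} lambda {X} x.

(* Main.v *)
(* Every a (x) x in Sh(A) is the product of j a and i x = 1 (x) x, where i is an
   algebra morphism from (A^{(x) n})_n with the quasi-shuffle product.  The
   recursion of that product says both that the map del dropping the leading 1
   of i x is a lambda-derivation along i, and that P_A is Rota-Baxter.  Then d_A
   is the product extension of d_0 and del, and the Leibniz rule reduces to a
   symmetry of the Leibniz expression (leibnizACA).  The lift of phi has to send
   a_0 (x) ... (x) a_n to phi a_0 * P (phi a_1 * P (... P (phi a_n))), which is
   multiplicative by the Rota-Baxter identity and commutes with d by d P = id. *)
Require Import Defs.
From mathcomp Require Import all_boot all_order all_algebra.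
From mathcomp Require Import boolp monalg ring.

Set Implicit Arguments.
Unset Strict Implicit.
Unset Printing Implicit Defensive.

Import GRing.Theory.
Local Open Scope ring_scope.

(** * Bilinearity in a commutative algebra and the weight-[lambda] Leibniz expression *)

Section ComPzAlg.
Context {k : comPzRingType} (lambda : k) (R : comPzAlgType k).

Lemma pz_mulr_linear (x : R) : linear (fun y : R => x * y).
Proof. by move=> c y z; rewrite mulrDr -pzscalerAr. Qed.

Lemma pz_mull_linear (x : R) : linear (fun y : R => y * x).
Proof. by move=> c y z; rewrite mulrDl -pzscalerAl. Qed.

(** Turns scaling into multiplication by a ring element, so that identities involving [lambda]
    become commutative ring identities, within reach of [ring]. *)
Lemma pz_scaleE (c : k) (x : R) : c *: x = (c *: (1 : R)) * x.
Proof. by rewrite -pzscalerAl mul1r. Qed.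

(* The value of d (u * v) forced by d u = u' and d v = v'. *)
Definition leibniz (u u' v v' : R) : R := u' * v + u * v' + lambda *: (u' * v').

(** In R[e]/(e^2 - [lambda] e), [leibniz u u' v v'] is the coefficient of e in (u + u' e)(v + v' e);
    the identity exchanges the two middle factors of a fourfold product. *)
Lemma leibnizACA (a a' b b' x x' y y' : R) :
  leibniz (a * b) (leibniz a a' b b') (x * y) (leibniz x x' y y') =
  leibniz (a * x) (leibniz a a' x x') (b * y) (leibniz b b' y y').
Proof.
have := @pz_scaleE lambda; move: (lambda *: (1 : R)) => l lE.
by rewrite /leibniz !lE; ring.
Qed.

Lemma leibnizC (u u' v v' : R) :
  leibniz u u' v v' = leibniz v v' u u'.
Proof.
rewrite /leibniz [u' * v]mulrC [u * v']mulrC [u' * v']mulrC.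
by rewrite [X in X + _]addrC.
Qed.

Lemma leibniz_linear_l (U : lmodType k) (f g : U -> R) v v' :
  linear f -> linear g -> linear (fun x => leibniz (f x) (g x) v v').
Proof.
move=> lf lg; apply: lin_add; [apply: lin_add|apply: lin_scale].
- exact: lin_comp lg (pz_mull_linear _).
- exact: lin_comp lf (pz_mull_linear _).
- exact: lin_comp lg (pz_mull_linear _).
Qed.

Lemma leibniz_linear_r (U : lmodType k) (f g : U -> R) v v' :
  linear f -> linear g -> linear (fun x => leibniz v v' (f x) (g x)).
Proof.
by move=> lf lg c x y; rewrite !(leibnizC v); apply: leibniz_linear_l.
Qed.

End ComPzAlg.

(** * The Rota-Baxter structure of Sh(A), via the morphisms j and i *)

Section MixableShuffle.
Context {k : comPzRingType} (lambda : k) (A : comPzAlgType k).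
Local Notation T := (tensors A).
Local Notation S := (Sh_alg lambda A).
Local Notation star := (@star k lambda A).

Definition i_Sh (x : T) : S := shT lambda 1 x.

Lemma i_Sh_linear : linear i_Sh.
Proof. exact: shT_linear. Qed.

(** This and the next four lemmas retype facts about the module [Sh] over the packed algebra
    [Sh_alg], so that its ring operations are the ones displayed. *)
Lemma Sh_shT_linear a : linear (shT lambda a : T -> S).
Proof. exact: shT_linear. Qed.

Lemma Sh_ext (M : lmodType k) (f g : S -> M) : linear f -> linear g ->
  (forall a x, f (shT lambda a x) = g (shT lambda a x)) -> forall x, f x = g x.
Proof. exact: shT_ext. Qed.

Lemma Sh_ext_sh (M : lmodType k) (f g : S -> M) : linear f -> linear g ->
  (forall a w, f (sh lambda a w) = g (sh lambda a w)) -> forall x, f x = g x.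
Proof. exact: sh_ext. Qed.

Lemma Sh_mul_shT a x b y :
  (shT lambda a x : S) * (shT lambda b y : S) =
  shT lambda (a * b) (star x y) :> S.
Proof. exact: sh_mul_shT. Qed.

Lemma Sh_one : 1 = sh lambda (1 : A) [::] :> S.
Proof. by []. Qed.

Lemma j_Sh_linear : linear (@j_Sh k lambda A).
Proof. exact: (sh_multilinear lambda A).2. Qed.

Lemma j_ShE a : j_Sh lambda a = shT lambda a (tens [::]) :> S.
Proof. by rewrite shT_tens. Qed.

Lemma shTE a x : shT lambda a x = j_Sh lambda a * i_Sh x :> S.
Proof. by rewrite j_ShE /i_Sh Sh_mul_shT mulr1 star1. Qed.

Lemma j_Sh_hom : is_alg_hom (@j_Sh k lambda A).
Proof.
split; first exact: j_Sh_linear.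
by split=> // a b; rewrite !j_ShE Sh_mul_shT star1.
Qed.

Lemma i_ShM x y : i_Sh (star x y) = i_Sh x * i_Sh y.
Proof. by rewrite /i_Sh Sh_mul_shT mulr1. Qed.

(** The projection of Sh(A) onto its summand A, induced by [f], is a left inverse. *)
Lemma j_Sh_inj : injective (@j_Sh k lambda A).
Proof.
pose f (a : A) (w : seq A) : A := if w is [::] then a else 0.
have mf : sh_multilin f.
  split=> [a u v c x y|w c x y]; last by case: w => //=; rewrite scaler0 addr0.
  by case: u => [|z u] /=; rewrite scaler0 addr0.
pose p : S -> A := sh_lin f.
have pK : cancel (j_Sh lambda) p by move=> a; apply: (sh_linE lambda mf).
exact: can_inj pK.
Qed.

(** The value 0 on the empty word, which i sends to 1, reflects that a derivation kills 1; the base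
    cases of [del_star] rest on it. *)
Definition del_word (w : seq A) : S :=
  if w is b :: w' then sh lambda b w' else 0.

Definition del : T -> S := tens_lin del_word.

Lemma del_word_multilin : multilin del_word.
Proof.
move=> [|z u] v c a b; first exact: (sh_multilinear lambda A).2.
exact: (sh_multilinear lambda A).1.
Qed.

Lemma del_linear : linear del.
Proof. exact: tens_lin_linear del_word_multilin. Qed.

Lemma del_tens w : del (tens w) = del_word w.
Proof. exact: (tens_linE del_word_multilin). Qed.

Lemma del_tcons a x : del (tcons a x) = shT lambda a x.
Proof.
move: x; apply: tens_ext.
- exact: lin_comp (tcons_linear a) del_linear.
- exact: Sh_shT_linear.
by move=> w; rewrite tcons_tens del_tens shT_tens.
Qed.

(** Extensionality in the shape of the recursion of [star]: one clause for the empty word, one for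
    [tcons]. *)
Lemma tensors_ext (M : lmodType k) (f g : T -> M) : linear f -> linear g ->
  f (tens [::]) = g (tens [::]) ->
  (forall a x, f (tcons a x) = g (tcons a x)) -> forall x, f x = g x.
Proof.
move=> lf lg f0 fc; apply: tens_ext => // -[//|a w].
by rewrite -tcons_tens fc.
Qed.

Lemma del_star x y :
  del (star x y) = leibniz lambda (i_Sh x) (del x) (i_Sh y) (del y).
Proof.
have li := i_Sh_linear; have ld := del_linear.
have i1 : i_Sh (tens [::]) = 1 by rewrite /i_Sh shT_tens.
move: x; apply: tensors_ext.
- exact: lin_comp (star_linear_l _ _) ld.
- exact: leibniz_linear_l.
- by rewrite star1 del_tens i1 /leibniz !mul0r mul1r add0r scaler0 addr0.
move=> a x; move: y; apply: tensors_ext.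
- exact: lin_comp (star_linear_r _ _) ld.
- exact: leibniz_linear_r.
- rewrite starC star1 del_tens i1 /leibniz !mulr0 mulr1.
  by rewrite scaler0 !addr0.
(* With the leading letter turned into a coefficient, the three terms of [star_cons] are, in order,
   those of the Leibniz expression. *)
move=> b y; rewrite star_cons !(linD ld) (linZ ld) !del_tcons /leibniz.
by rewrite !Sh_mul_shT mulr1 mul1r.
Qed.

Lemma P_Sh_multilin : sh_multilin (fun a w => sh lambda (1 : A) (a :: w)).
Proof.
split=> [a u v c x y|w c x y].
  exact: ((sh_multilinear lambda A).1 1 (a :: u)).
exact: ((sh_multilinear lambda A).1 1 [::]).
Qed.

Lemma P_Sh_linear : linear (@P_Sh k lambda A).
Proof. exact: sh_lin_linear P_Sh_multilin. Qed.

(** Values of P_A are values of i on nonempty words, so that their products are governed by [i_ShM]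
    and [star_cons]. *)
Lemma P_Sh_shT a x : P_Sh lambda (shT lambda a x : S) = i_Sh (tcons a x).
Proof.
move: x; apply: tens_ext.
- exact: lin_comp (Sh_shT_linear a) P_Sh_linear.
- exact: lin_comp (tcons_linear a) i_Sh_linear.
move=> w; rewrite tcons_tens /i_Sh !shT_tens.
exact: (sh_linE lambda P_Sh_multilin).
Qed.

Lemma P_Sh_rota_baxter : is_rota_baxter lambda (@P_Sh k lambda A).
Proof.
have lP := P_Sh_linear.
have lr := @pz_mulr_linear _ S; have ll := @pz_mull_linear _ S.
split=> // x y; move: x; apply: Sh_ext.
- exact: lin_comp lP (ll _).
- apply: lin_add; [apply: lin_add|apply: lin_scale].
  + exact: lin_comp (ll _) lP.
  + exact: lin_comp (lin_comp lP (ll _)) lP.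
  + exact: lin_comp (ll _) lP.
move=> a x; move: y; apply: Sh_ext.
- exact: lin_comp lP (lr _).
- apply: lin_add; [apply: lin_add|apply: lin_scale].
  + exact: lin_comp (lin_comp lP (lr _)) lP.
  + exact: lin_comp (lr _) lP.
  + exact: lin_comp (lr _) lP.
move=> b y; rewrite !P_Sh_shT -i_ShM star_cons.
rewrite !(linD i_Sh_linear) (linZ i_Sh_linear).
by rewrite /i_Sh !Sh_mul_shT !P_Sh_shT mulr1 mul1r.
Qed.

(** * The operator d_A: Leibniz rule and the relation with P_A *)

Section Derivation.
Variable d0 : A -> A.
Hypothesis Hd0 : is_diff lambda d0.

Lemma d_Sh_multilin : sh_multilin (fun a w =>
  if w is b :: w' then
    sh lambda (d0 a) w + sh lambda (a * b) w'
    + lambda *: sh lambda (d0 a * b) w'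
  else sh lambda (d0 a) [::]).
Proof.
have [m l] := sh_multilinear lambda A; have ld := diff_linear Hd0.
split=> [a [|z u] v c x y|[|z w]].
(* The first letter is also multiplied into the coefficient, so both linearities of [sh] are needed
   here; later letters are merely carried along. *)
- rewrite !cat0s (m _ [::]) !mulrDr -!pzscalerAr !l !scalerDr !scalerA.
  rewrite [c * _]mulrC -!scalerA.
  by rewrite (AC (2*2*2) ((1*3*5)*(2*4*6))).
- rewrite !cat_cons (m _ (z :: u)) !m !scalerDr !scalerA.
  rewrite [c * _]mulrC -!scalerA.
  by rewrite (AC (2*2*2) ((1*3*5)*(2*4*6))).
- exact: lin_comp ld (l _).
- apply: lin_add; [apply: lin_add|apply: lin_scale].
  + exact: lin_comp ld (l _).
  + exact: lin_comp (pz_mull_linear z) (l _).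
  + exact: lin_comp ld (lin_comp (pz_mull_linear z) (l _)).
Qed.

Lemma d_Sh_linear : linear (d_Sh lambda d0).
Proof. exact: sh_lin_linear d_Sh_multilin. Qed.

Lemma d_ShE a x : d_Sh lambda d0 (j_Sh lambda a * i_Sh x) =
  leibniz lambda (j_Sh lambda a) (j_Sh lambda (d0 a)) (i_Sh x) (del x).
Proof.
move: x; apply: tens_ext.
- exact: lin_comp (lin_comp i_Sh_linear (pz_mulr_linear _)) d_Sh_linear.
- exact: leibniz_linear_r i_Sh_linear del_linear.
move=> w; rewrite /leibniz -!shTE del_tens !shT_tens.
rewrite [LHS](sh_linE lambda d_Sh_multilin) /=.
(* On the empty word [del] vanishes, which leaves the separate clause of [d_Sh] for a single tensor
   factor. *)
case: w => [|b w] /=; first by rewrite !mulr0 scaler0 !addr0.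
by rewrite -!shT_tens !j_ShE !Sh_mul_shT !star1.
Qed.

Lemma d_Sh_j a : d_Sh lambda d0 (j_Sh lambda a) = j_Sh lambda (d0 a).
Proof. exact: (sh_linE lambda d_Sh_multilin). Qed.

Lemma d_Sh_diff : is_diff lambda (d_Sh lambda d0).
Proof.
have ld := d_Sh_linear.
have lr := @pz_mulr_linear _ S; have ll := @pz_mull_linear _ S.
split=> [//|x y|]; last first.
  rewrite Sh_one [LHS](d_Sh_j 1) (diff_one Hd0).
  exact: lin0 j_Sh_linear.
rewrite -/(leibniz lambda x _ y _).
move: x; apply: Sh_ext.
- exact: lin_comp (ll _) ld.
- exact: leibniz_linear_l.
move=> a x; move: y; apply: Sh_ext.
- exact: lin_comp (lr _) ld.
- exact: leibniz_linear_r.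
(* [leibnizACA] collects the two j-factors and the two i-factors; the former are handled by the
   Leibniz rule of [d0], the latter by [del_star]. *)
move=> b y; rewrite Sh_mul_shT !shTE !d_ShE -leibnizACA -del_star.
have [_ [_ jM]] := j_Sh_hom; rewrite jM i_ShM; congr leibniz.
rewrite (diff_leibniz Hd0) !(linD j_Sh_linear) (linZ j_Sh_linear).
by rewrite /leibniz !jM.
Qed.

Lemma d_Sh_P x : d_Sh lambda d0 (P_Sh lambda x) = x.
Proof.
move: x; apply: Sh_ext => //.
  exact: lin_comp P_Sh_linear d_Sh_linear.
(* The coefficient is 1 and [d0 1 = 0], so only the [del] term survives, and it strips the 1 that
   P_A prepended. *)
move=> a x; rewrite P_Sh_shT -[i_Sh _]mul1r Sh_one d_ShE (diff_one Hd0).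
rewrite (lin0 j_Sh_linear) /leibniz !mul0r scaler0 add0r addr0 del_tcons.
by rewrite [LHS]mul1r.
Qed.

Lemma Sh_diff_rota_baxter :
  is_diff_rota_baxter lambda (d_Sh lambda d0) (@P_Sh k lambda A).
Proof.
by split; [apply: d_Sh_diff | apply: P_Sh_rota_baxter | apply: d_Sh_P].
Qed.

Lemma j_Sh_diff_hom : is_diff_hom d0 (d_Sh lambda d0) (@j_Sh k lambda A).
Proof. by split=> [|a]; rewrite ?d_Sh_j //; apply: j_Sh_hom. Qed.

End Derivation.

End MixableShuffle.

(** * Universal property of Sh(A) over a differential algebra *)

Section FreeOnDifferentialAlgebra.
Context {k : comPzRingType} (lambda : k) (A : comPzAlgType k).
Context (d0 : A -> A) (Hd0 : is_diff lambda d0).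
Context (R : comPzAlgType k) (d P : R -> R).
Hypothesis HR : is_diff_rota_baxter lambda d P.
Context (phi : A -> R) (Hphi : is_diff_hom d0 d phi).
Local Notation T := (tensors A).
Local Notation S := (Sh_alg lambda A).

Let phi_linear : linear phi := hom_linear (dhom_alg Hphi).
Let P_linear : linear P := rb_linear (drb_rb HR).
Let phi1 : phi 1 = 1 := (hom_monoid (dhom_alg Hphi)).1.
Let phiM : {morph phi : x y / x * y} := (hom_monoid (dhom_alg Hphi)).2.

(** An abstract iterated integral in the sense of Chen, with [P] in the role of integration. *)
Definition iter_int (w : seq A) : R := foldr (fun a r => P (phi a * r)) 1 w.

Lemma iter_int_multilin : multilin iter_int.
Proof.
elim=> [|z u IH] v c a b /=.
  by rewrite phi_linear mulrDl -pzscalerAl P_linear.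
by rewrite IH mulrDr -pzscalerAr P_linear.
Qed.

Definition iter_intT : T -> R := tens_lin iter_int.

Lemma iter_intT_linear : linear iter_intT.
Proof. exact: tens_lin_linear iter_int_multilin. Qed.

Lemma iter_intT_tens w : iter_intT (tens w) = iter_int w.
Proof. exact: (tens_linE iter_int_multilin). Qed.

Lemma iter_intT_tcons a x : iter_intT (tcons a x) = P (phi a * iter_intT x).
Proof.
have lQ := iter_intT_linear; move: x; apply: tens_ext.
- exact: lin_comp (tcons_linear a) lQ.
- exact: lin_comp (lin_comp lQ (pz_mulr_linear _)) P_linear.
by move=> w; rewrite tcons_tens !iter_intT_tens.
Qed.

Lemma iter_intT_star x y :
  iter_intT (star lambda x y) = iter_intT x * iter_intT y.
Proof.
have lQ := iter_intT_linear.
move: x; apply: tens_ext.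
- exact: lin_comp (star_linear_l _ _) lQ.
- exact: lin_comp lQ (pz_mull_linear _).
move=> u; move: y; apply: tens_ext.
- exact: lin_comp (star_linear_r _ _) lQ.
- exact: lin_comp lQ (pz_mulr_linear _).
(* The terms of [star_cons] shorten the left word, the right word, or both: [IHu], valid for every
   [v], covers the first and third, [IHv] the second. *)
elim: u => [|a u IHu] v.
  by rewrite star1 [iter_intT (tens [::])]iter_intT_tens mul1r.
elim: v => [|b v IHv].
  by rewrite starC star1 [iter_intT (tens [::])]iter_intT_tens mulr1.
rewrite -!tcons_tens star_cons !(linD lQ) (linZ lQ) !iter_intT_tcons.
rewrite (tcons_tens b v) (tcons_tens a u) !IHu IHv -(tcons_tens a u).
rewrite -(tcons_tens b v) !iter_intT_tcons (rb_eq (drb_rb HR)) phiM.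
(* The Rota-Baxter expansion matches [star_cons] term by term, up to reordering factors under each
   [P]. *)
by congr (P _ + P _ + lambda *: P _); ring.
Qed.

Definition Sh_lift : S -> R := sh_lin (fun a w => phi a * iter_int w).

Lemma Sh_lift_multilin : sh_multilin (fun a w => phi a * iter_int w).
Proof.
split=> [a u v c x y|w c x y].
  by rewrite iter_int_multilin mulrDr -pzscalerAr.
by rewrite phi_linear mulrDl -pzscalerAl.
Qed.

Lemma Sh_lift_linear : linear Sh_lift.
Proof. exact: sh_lin_linear Sh_lift_multilin. Qed.

Lemma Sh_lift_sh a w : Sh_lift (sh lambda a w) = phi a * iter_int w.
Proof. exact: (sh_linE lambda Sh_lift_multilin). Qed.

Lemma Sh_lift_shT a x : Sh_lift (shT lambda a x) = phi a * iter_intT x.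
Proof.
move: x; apply: tens_ext.
- exact: lin_comp (Sh_shT_linear lambda a) Sh_lift_linear.
- exact: lin_comp iter_intT_linear (pz_mulr_linear _).
by move=> w; rewrite shT_tens iter_intT_tens Sh_lift_sh.
Qed.

Lemma Sh_lift_j a : Sh_lift (j_Sh lambda a) = phi a.
Proof. by rewrite [LHS]Sh_lift_sh mulr1. Qed.

Lemma Sh_liftM : {morph Sh_lift : x y / x * y}.
Proof.
have lL := Sh_lift_linear => x y; move: x; apply: Sh_ext.
- exact: lin_comp (pz_mull_linear _) lL.
- exact: lin_comp lL (pz_mull_linear _).
move=> a x; move: y; apply: Sh_ext.
- exact: lin_comp (pz_mulr_linear _) lL.
- exact: lin_comp lL (pz_mulr_linear _).
by move=> b y; rewrite Sh_mul_shT !Sh_lift_shT phiM iter_intT_star mulrACA.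
Qed.

Lemma Sh_lift_d x : Sh_lift (d_Sh lambda d0 x) = d (Sh_lift x).
Proof.
have lL := Sh_lift_linear; have ld := diff_linear (drb_diff HR).
move: x; apply: Sh_ext_sh.
- exact: lin_comp (d_Sh_linear Hd0) lL.
- exact: lin_comp lL ld.
move=> a w; rewrite [d_Sh _ _ _](sh_linE lambda (d_Sh_multilin Hd0)) Sh_lift_sh.
case: w => [|b w] /=; first by rewrite Sh_lift_sh !mulr1 (dhom_d Hphi).
rewrite !(linD lL) (linZ lL) !Sh_lift_sh /= !phiM !(dhom_d Hphi).
(* One use of the Leibniz rule suffices: d P = id removes the outermost [P], and the inner integrals
   are never differentiated. *)
by rewrite (diff_leibniz (drb_diff HR)) (drb_section HR) !mulrA.
Qed.

Lemma Sh_lift_P x : Sh_lift (P_Sh lambda x) = P (Sh_lift x).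
Proof.
have lL := Sh_lift_linear; move: x; apply: Sh_ext.
- exact: lin_comp (@P_Sh_linear k lambda A) lL.
- exact: lin_comp lL P_linear.
move=> a x; rewrite P_Sh_shT /i_Sh !Sh_lift_shT iter_intT_tcons.
by rewrite phi1 mul1r.
Qed.

Lemma Sh_lift_hom :
  is_diff_rota_baxter_hom (d_Sh lambda d0) (@P_Sh k lambda A) d P Sh_lift.
Proof.
split; last exact: Sh_lift_P.
split; last exact: Sh_lift_d.
split; first exact: Sh_lift_linear.
split; last exact: Sh_liftM.
by rewrite Sh_one Sh_lift_sh phi1 mulr1.
Qed.

(** Sh(A) is spanned by what j(A) generates under product and P_A: i of the word [b :: w] is P_A of
    j b times i of [w], so induction on the word forces every value. *)
Lemma Sh_lift_unique (psi : S -> R) :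
  is_diff_rota_baxter_hom (d_Sh lambda d0) (@P_Sh k lambda A) d P psi ->
  (forall a, psi (j_Sh lambda a) = phi a) -> psi =1 Sh_lift.
Proof.
case=> -[[lpsi [psi1 psiM]] _] psiP psij.
apply: Sh_ext_sh => //; first exact: Sh_lift_linear.
move=> a w; rewrite Sh_lift_sh -shT_tens shTE psiM psij; congr (_ * _).
elim: w a => [|b w IH] a; first by rewrite /i_Sh shT_tens -Sh_one psi1.
by rewrite -tcons_tens -P_Sh_shT psiP shTE psiM psij IH.
Qed.

Lemma Sh_free : exists! psi : S -> R,
  is_diff_rota_baxter_hom (d_Sh lambda d0) (@P_Sh k lambda A) d P psi
  /\ (forall a : A, psi (j_Sh lambda a) = phi a).
Proof.
exists Sh_lift; split; first by split; [apply: Sh_lift_hom | apply: Sh_lift_j].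
move=> psi [hpsi psij]; apply/funext => x.
by rewrite (Sh_lift_unique hpsi psij).
Qed.

End FreeOnDifferentialAlgebra.

(** * Universal property of k{X}, and its composition with that of Sh *)

Section FreeDifferentialAlgebra.
Context {k : comPzRingType} (lambda : k) (X : Type).
Context (R : comPzAlgType k) (d : R -> R) (Hd : is_diff lambda d).
Variable phi : X -> R.
Local Notation Y := ({classic X} * nat)%type.
Local Notation D := (diff_poly k X).
Local Notation pword s := (\prod_(y <- s) @pvar k Y y).

Definition diff_poly_lift : D -> R :=
  fm_lin (fun m : {cmonom Y} =>
    \prod_(y <- cmonom_vars m) iter y.2 d (phi y.1)).

Lemma diff_poly_lift_linear : linear diff_poly_lift.
Proof. exact: fm_lin_linear. Qed.

(** Frees the lift from the particular listing [cmonom_vars]: reordering the variables does not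
    change a product in the commutative [R]. *)
Lemma diff_poly_lift_word (s : seq Y) :
  diff_poly_lift (pword s) = \prod_(y <- s) iter y.2 d (phi y.1).
Proof.
pose m := \big[mmul/mone]_(y <- s) ucm y : {cmonom Y}.
have sm : perm_eq (cmonom_vars m) s.
  apply/allP => y _ /=; rewrite count_cmonom_vars /m; apply/eqP.
  elim: s {m} => [|z s IH]; first by rewrite big_nil cm1.
  by rewrite big_cons cmM cmU /= IH.
by rewrite -(cmonom_vars_perm k sm) /diff_poly_lift fm_linE (perm_big _ sm).
Qed.

Lemma diff_poly_lift_hom :
  is_diff_hom (@d_poly k lambda X) d diff_poly_lift.
Proof.
have lf := diff_poly_lift_linear; have [ld dM d1] := Hd.
have lr := @pz_mulr_linear _ D; have ll := @pz_mull_linear _ D.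
have var x n : diff_poly_lift (dvar x n) = iter n d (phi x).
  by have := diff_poly_lift_word [:: (x, n)]; rewrite !big_seq1.
have fM x y : diff_poly_lift (x * y) = diff_poly_lift x * diff_poly_lift y.
  move: x; apply: diff_poly_ext.
  - exact: lin_comp (ll _) lf.
  - exact: lin_comp lf (pz_mull_linear _).
  move=> s; move: y; apply: diff_poly_ext.
  - exact: lin_comp (lr _) lf.
  - exact: lin_comp lf (pz_mulr_linear _).
  by move=> t; rewrite -big_cat !diff_poly_lift_word big_cat.
have lf1 : diff_poly_lift 1 = 1.
  by have := diff_poly_lift_word [::]; rewrite !big_nil.
split; first by split=> //; split.
apply: diff_poly_ext.
- exact: lin_comp (@d_poly_linear k lambda X) lf.
- exact: lin_comp lf ld.
move=> s; rewrite d_poly_word.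
(* The recursion of [dword] is the Leibniz rule for the first variable, which [d] satisfies on the
   image as well. *)
elim: s => [|[x n] s IH].
  by rewrite big_nil (lin0 lf) lf1 d1.
by rewrite big_cons /= !(linD lf) (linZ lf) !fM IH dM !var.
Qed.

Lemma diff_poly_lift_var x : diff_poly_lift (dvar x 0) = phi x.
Proof. by have := diff_poly_lift_word [:: (x, 0)]; rewrite !big_seq1. Qed.

Lemma diff_poly_lift_unique (f : D -> R) :
  is_diff_hom (@d_poly k lambda X) d f ->
  (forall x, f (dvar x 0) = phi x) -> f =1 diff_poly_lift.
Proof.
case=> -[lf [f1 fM]] fd fv.
(* Commuting with the derivations propagates the values from x^{(0)} to all x^{(n)}. *)
have fvar x n : f (dvar x n) = iter n d (phi x).
  by elim: n => [|n IH] //=; rewrite -IH -fd d_poly_var.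
apply: diff_poly_ext => //; first exact: diff_poly_lift_linear.
move=> s; rewrite diff_poly_lift_word.
elim: s => [|[x n] s IH]; first by rewrite !big_nil.
by rewrite !big_cons fM IH [f _]fvar.
Qed.

End FreeDifferentialAlgebra.

(** The two universal properties compose: a map on X extends to k{X}, then to Sh(k{X}). *)
Lemma Sh_diff_poly_free (k : comPzRingType) (lambda : k) (X : Type)
    (R : comPzAlgType k) (d P : R -> R) :
  is_diff_rota_baxter lambda d P -> forall phi : X -> R,
  exists! psi : Sh_alg lambda (diff_poly k X) -> R,
    is_diff_rota_baxter_hom (d_Sh lambda (@d_poly k lambda X))
      (@P_Sh k lambda (diff_poly k X)) d P psi
    /\ (forall x : X, psi (j_diff_poly lambda x) = phi x).
Proof.
move=> HR phi; have Hd := drb_diff HR.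
have Hdp := @d_poly_diff k lambda X.
have [psi [[hpsi psij] psiU]] :=
  Sh_free Hdp HR (diff_poly_lift_hom Hd phi).
exists psi; split.
  by split=> // x; rewrite [LHS]psij diff_poly_lift_var.
move=> psi' [hpsi' psi'j]; apply: psiU; split=> // a.
(* The composite of [psi'] with j is a differential homomorphism extending [phi], hence the lift to
   k{X}; this makes [psiU] applicable to [psi']. *)
apply: (diff_poly_lift_unique (lambda := lambda)
  (f := fun a => psi' (j_Sh lambda a))) => //.
have [hj jd] := j_Sh_diff_hom Hdp; have [lj [j1 jM]] := hj.
have [[[lp [p1 pM]] pd] _] := hpsi'.
split=> [|x]; last by rewrite jd pd.
split; first exact: lin_comp lj lp.
by split=> [|x y]; rewrite ?j1 ?p1 // jM pM.
Qed.

Theorem theorem3p2 (k : comPzRingType) (lambda : k) (A : comPzAlgType k)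
    (d0 : A -> A) (Hd0 : is_diff lambda d0) :
  [/\ [/\ is_diff_rota_baxter lambda (d_Sh lambda d0) (@P_Sh k lambda A),
          injective (@j_Sh k lambda A)
        & is_diff_hom d0 (d_Sh lambda d0) (@j_Sh k lambda A)],
      forall (R : comPzAlgType k) (d P : R -> R),
        is_diff_rota_baxter lambda d P ->
        forall phi : A -> R, is_diff_hom d0 d phi ->
        exists! psi : Sh_alg lambda A -> R,
          is_diff_rota_baxter_hom (d_Sh lambda d0) (@P_Sh k lambda A) d P psi
          /\ (forall a : A, psi (j_Sh lambda a) = phi a)
    & forall X : Type,
        is_diff_rota_baxter lambda (d_Sh lambda (@d_poly k lambda X))
          (@P_Sh k lambda (diff_poly k X))
        /\ forall (R : comPzAlgType k) (d P : R -> R),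
          is_diff_rota_baxter lambda d P ->
          forall phi : X -> R,
          exists! psi : Sh_alg lambda (diff_poly k X) -> R,
            is_diff_rota_baxter_hom (d_Sh lambda (@d_poly k lambda X))
              (@P_Sh k lambda (diff_poly k X)) d P psi
            /\ (forall x : X, psi (j_diff_poly lambda x) = phi x)].
Proof.
split.
- split; first exact: Sh_diff_rota_baxter.
    exact: j_Sh_inj.
  exact: j_Sh_diff_hom.
- by move=> R d P HR phi Hphi; apply: Sh_free.
move=> X; split; first exact/Sh_diff_rota_baxter/d_poly_diff.
exact: Sh_diff_poly_free.
Qed.
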